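(* Let $p$ be a prime number, let $\mathbf{k}$ be a commutative $\mathbb{F}_p$-algebra, and let $L$ be a free $\mathbf{k}$-module. Then $(\mathfrak{h}'_p)^{\star}=\operatorname{Ker}(\mathbf{t}')$.
   Context: Let $\mathbb{N}=\{0,1,2,\ldots\}$; all tensor products are over $\mathbf{k}$. $T(L)=\bigoplus_{n\in\mathbb{N}} L^{\otimes n}$ is the tensor algebra of $L$ (product = concatenation of tensors); $L$ is identified with $L^{\otimes 1}$. $\mathbf{t}':T(L)\to T(L)$ is the $\mathbf{k}$-linear map given by $\mathbf{t}'(u_1\otimes u_2\otimes\cdots\otimes u_k)=\sum_{i=1}^{k}u_i\otimes u_1\otimes u_2\otimes\cdots\otimes\widehat{u_i}\otimes\cdots\otimes u_k$ for all $k\in\mathbb{N}$ and $u_1,\ldots,u_k\in L$, where $\widehat{u_i}$ means that the factor $u_i$ is omitted from its usual place (so $\mathbf{t}'$ is $0$ on $L^{\otimes 0}$). The commutator on $T(L)$ is $[U,V]=UV-VU$. For $\mathbf{k}$-submodules $A,B$ of $T(L)$, $[A,B]$ denotes the $\mathbf{k}$-linear span of all $[U,V]$ with $U\in A$, $V\in B$. Define $\mathbf{k}$-submodules $L'_1,L'_2,L'_3,\ldots$ of $T(L)$ recursively by $L'_1=L$ and $L'_{i+1}=[L,L'_i]$. Let $\overline{\mathfrak{g}}'=L'_2+L'_3+L'_4+\cdots$. Let $P_p$ be the $\mathbf{k}$-submodule of $L^{\otimes p}$ spanned by all $x^p=x\otimes x\otimes\cdots\otimes x$ ($p$ factors) with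 $x\in L$. Let $\mathfrak{h}'_p=\overline{\mathfrak{g}}'+P_p$. For a $\mathbf{k}$-submodule $U$ of a $\mathbf{k}$-algebra $A$, $U^{\star}=U^0+U^1+U^2+\cdots$ denotes the $\mathbf{k}$-subalgebra of $A$ generated by $U$, where $U^i=UU\cdots U$ ($i$ factors) and $U^0=\mathbf{k}\cdot 1_A$. *)

(* Defs.v *)
From HB Require Import structures.
From mathcomp Require Import all_boot all_order all_algebra.
From mathcomp Require Import generic_quotient.
From mathcomp Require Import boolp classical_sets.

Set Implicit Arguments.
Unset Strict Implicit.
Unset Printing Implicit Defensive.

Import GRing.Theory.

Local Open Scope quotient_scope.
Local Open Scope classical_set_scope.
Local Open Scope ring_scope.

(* The base ring is a comPzRingType, so that the zero ring is allowed. The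
   tensor algebra below then only carries its pzRingType and lmodType instances
   (with tensor_scaleAl and tensor_scaleAr), because the algebra structures of
   MathComp require 1 != 0. *)

Section Submodules.

Context {k : pzRingType} {V : lmodType k}.
Implicit Types (S A B : set V).

Definition submodule S : Prop :=
  S 0 /\ (forall (a : k) x y, S x -> S y -> S (a *: x + y)).

Definition span S : set V := smallest submodule S.

Definition addsub A B : set V := [set x + y | x in A & y in B].

(* The sum of a family of submodules. *)
Definition sumsub (A : nat -> set V) : set V := span (\bigcup_i A i).

Definition lin_indep S : Prop :=
  forall s : seq V, uniq s -> (forall v, v \in s -> S v) ->
  forall c : V -> k, \sum_(v <- s) c v *: v = 0 ->
  forall v, v \in s -> c v = 0.

End Submodules.

(* Over the zero ring V = 0 has the empty basis, so describing a basis as a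
   subset rather than as a family loses nothing. *)
Definition free_module (k : pzRingType) (V : lmodType k) : Prop :=
  exists B : set V, lin_indep B /\ span B = setT.

(* The tensor algebra of L: formal linear combinations of words over L (a list
   of pairs (a, w) stands for the sum of the a w), modulo the relations that
   make the word [:: u_1; ...; u_n] multilinear in its letters. Each relation
   involves words of a single length n, and the part spanned by the words of
   length n is the n-th tensor power of L. *)
Section TensorAlgebra.

Variables (k : comPzRingType) (L : lmodType k).

Inductive tensor_eq : seq (k * seq L) -> seq (k * seq L) -> Prop :=
| tensor_eq_refl x : tensor_eq x x
| tensor_eq_sym x y : tensor_eq x y -> tensor_eq y x
| tensor_eq_trans y x z : tensor_eq x y -> tensor_eq y z -> tensor_eq x z
| tensor_eq_catC x y : tensor_eq (x ++ y) (y ++ x)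
| tensor_eq_catr x x' y : tensor_eq x x' -> tensor_eq (x ++ y) (x' ++ y)
| tensor_eq_coef0 w : tensor_eq [:: (0, w)] [::]
| tensor_eq_coefD a b w : tensor_eq [:: (a + b, w)] [:: (a, w); (b, w)]
| tensor_eq_vecD a w1 u v w2 :
    tensor_eq [:: (a, w1 ++ (u + v) :: w2)]
              [:: (a, w1 ++ u :: w2); (a, w1 ++ v :: w2)]
| tensor_eq_vecZ a c w1 u w2 :
    tensor_eq [:: (a, w1 ++ (c *: u) :: w2)] [:: (a * c, w1 ++ u :: w2)].

Definition tensor_eqb : rel (seq (k * seq L)) := fun x y => `[< tensor_eq x y >].

Lemma tensor_eqb_refl : reflexive tensor_eqb.
Proof. by move=> x; apply/asboolP; exact: tensor_eq_refl. Qed.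

Lemma tensor_eqb_sym : symmetric tensor_eqb.
Proof. by move=> x y; apply/asboolP/asboolP => /tensor_eq_sym. Qed.

Lemma tensor_eqb_trans : transitive tensor_eqb.
Proof.
by move=> y x z /asboolP xy /asboolP yz; apply/asboolP; exact: tensor_eq_trans xy yz.
Qed.

Canonical tensor_equiv :=
  EquivRel tensor_eqb tensor_eqb_refl tensor_eqb_sym tensor_eqb_trans.

Definition tensor_algebra := {eq_quot tensor_equiv}.
Local Notation T := tensor_algebra.

HB.instance Definition _ := Choice.on T.
HB.instance Definition _ := EqQuotient.on T.

Lemma pi_tensorP x y : x = y %[mod T] <-> tensor_eq x y.
Proof.
split=> [/eqP|xy]; last by apply/eqP; rewrite eqmodE; apply/asboolP.
by rewrite eqmodE => /asboolP.
Qed.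

Lemma tensor_eq_catl x y y' : tensor_eq y y' -> tensor_eq (x ++ y) (x ++ y').
Proof.
move=> yy'; apply: tensor_eq_trans (tensor_eq_catC _ _) _.
apply: tensor_eq_trans (tensor_eq_catC _ _).
exact: tensor_eq_catr.
Qed.

Lemma tensor_eq_cat x x' y y' :
  tensor_eq x x' -> tensor_eq y y' -> tensor_eq (x ++ y) (x' ++ y').
Proof.
move=> xx' yy'; apply: tensor_eq_trans (tensor_eq_catr _ xx') _.
exact: tensor_eq_catl.
Qed.

Definition scale_words (c : k) (x : seq (k * seq L)) :=
  [seq (c * aw.1, aw.2) | aw <- x].

Lemma tensor_eq_scale c x y :
  tensor_eq x y -> tensor_eq (scale_words c x) (scale_words c y).
Proof.
rewrite /scale_words; elim=> {x y} //=.
- by move=> x; exact: tensor_eq_refl.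
- by move=> x y _; exact: tensor_eq_sym.
- by move=> y x z _ xy _; exact: tensor_eq_trans.
- by move=> x y; rewrite !map_cat; exact: tensor_eq_catC.
- by move=> x x' y _ xx'; rewrite !map_cat; exact: tensor_eq_catr.
- by move=> w; rewrite mulr0; exact: tensor_eq_coef0.
- by move=> a b w; rewrite mulrDr; exact: tensor_eq_coefD.
- by move=> a w1 u v w2; exact: tensor_eq_vecD.
- by move=> a b w1 u w2; rewrite mulrA; exact: tensor_eq_vecZ.
Qed.

Lemma tensor_eq_scaleD a b x :
  tensor_eq (scale_words (a + b) x) (scale_words a x ++ scale_words b x).
Proof.
elim: x => [|[c w] x IHx] /=; first exact: tensor_eq_refl.
rewrite mulrDl -cat1s.
apply: tensor_eq_trans (tensor_eq_cat (tensor_eq_coefD _ _ _) IHx) _.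
rewrite /= -[(a * c, w) :: _]cat1s -[X in tensor_eq _ X]cat1s.
apply: tensor_eq_catl.
rewrite -cat1s -[X in tensor_eq _ (_ ++ X)]cat1s !catA.
exact/tensor_eq_catr/tensor_eq_catC.
Qed.

Lemma tensor_eq_scale0 x : tensor_eq (scale_words 0 x) [::].
Proof.
elim: x => [|[c w] x IHx] /=; first exact: tensor_eq_refl.
rewrite mul0r -cat1s -[X in tensor_eq _ X]cats0.
exact: tensor_eq_cat (tensor_eq_coef0 _) IHx.
Qed.

Definition tensor_zero : T := \pi_T [::].
Definition tensor_add (s t : T) : T := \pi_T (repr s ++ repr t).
Definition tensor_scale (c : k) (t : T) : T := \pi_T (scale_words c (repr t)).
Definition tensor_opp (t : T) : T := tensor_scale (-1) t.

Lemma pi_tensor_add x y : tensor_add (\pi_T x) (\pi_T y) = \pi_T (x ++ y).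
Proof. by apply/pi_tensorP/tensor_eq_cat; apply/pi_tensorP; rewrite reprK. Qed.

Lemma pi_tensor_scale c x : tensor_scale c (\pi_T x) = \pi_T (scale_words c x).
Proof. by apply/pi_tensorP/tensor_eq_scale; apply/pi_tensorP; rewrite reprK. Qed.

Lemma tensor_addA : associative tensor_add.
Proof.
move=> s t u; elim/quotW: s => x; elim/quotW: t => y; elim/quotW: u => z.
by rewrite (pi_tensor_add y z) (pi_tensor_add x y) !pi_tensor_add catA.
Qed.

Lemma tensor_addC : commutative tensor_add.
Proof.
move=> s t; elim/quotW: s => x; elim/quotW: t => y; rewrite !pi_tensor_add.
exact/pi_tensorP/tensor_eq_catC.
Qed.

Lemma tensor_add0 : left_id tensor_zero tensor_add.
Proof. by move=> t; elim/quotW: t => x; rewrite pi_tensor_add. Qed.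

Lemma tensor_scale1 : left_id 1 tensor_scale.
Proof.
move=> t; elim/quotW: t => x; rewrite pi_tensor_scale; congr \pi_T.
by elim: x => [|[a w] x IHx] //=; rewrite mul1r IHx.
Qed.

Lemma tensor_scaleDl (t : T) :
  {morph tensor_scale^~ t : a b / a + b >-> tensor_add a b}.
Proof.
move=> a b; elim/quotW: t => x; rewrite !pi_tensor_scale pi_tensor_add.
exact/pi_tensorP/tensor_eq_scaleD.
Qed.

Lemma tensor_addN : left_inverse tensor_zero tensor_opp tensor_add.
Proof.
move=> t; rewrite /tensor_opp -[X in tensor_add _ X]tensor_scale1.
rewrite -tensor_scaleDl addNr; elim/quotW: t => x.
by rewrite pi_tensor_scale; apply/pi_tensorP/tensor_eq_scale0.
Qed.

HB.instance Definition _ := GRing.isZmodule.Build T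
  tensor_addA tensor_addC tensor_add0 tensor_addN.

Lemma tensor_scaleA a b t : tensor_scale a (tensor_scale b t) = tensor_scale (a * b) t.
Proof.
elim/quotW: t => x; rewrite (pi_tensor_scale b) !pi_tensor_scale; congr \pi_T.
by rewrite /scale_words -map_comp; apply: eq_map => aw /=; rewrite mulrA.
Qed.

Lemma tensor_scaleDr : right_distributive tensor_scale +%R.
Proof.
move=> a s t; elim/quotW: s => x; elim/quotW: t => y.
rewrite [X in tensor_scale _ X]pi_tensor_add [RHS]/GRing.add /=.
by rewrite !pi_tensor_scale pi_tensor_add /scale_words map_cat.
Qed.

HB.instance Definition _ := GRing.Zmodule_isLmodule.Build k T
  tensor_scaleA tensor_scale1 tensor_scaleDr tensor_scaleDl.

(* The pure tensor of the letters of w. *)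
Definition ten (w : seq L) : T := \pi_T [:: (1, w)].

Lemma pi_tensorE x : \pi_T x = \sum_(aw <- x) aw.1 *: ten aw.2.
Proof.
elim: x => [|[a w] x IHx]; first by rewrite big_nil.
rewrite big_cons -IHx /= -cat1s -pi_tensor_add; congr (_ + _).
by rewrite [RHS]pi_tensor_scale /= mulr1.
Qed.

Lemma tensor_spanE (t : T) : t = \sum_(aw <- repr t) aw.1 *: ten aw.2.
Proof. by rewrite -pi_tensorE reprK. Qed.

Lemma tensor_ext (M : lmodType k) (f g : {linear T -> M}) :
  (forall w, f (ten w) = g (ten w)) -> f =1 g.
Proof.
move=> fg t; rewrite (tensor_spanE t) !linear_sum; apply: eq_bigr => aw _.
by rewrite !linearZ fg.
Qed.

Definition multilinear (M : lmodType k) (f : seq L -> M) : Prop :=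
  forall w1 w2 (a : k) u v,
    f (w1 ++ (a *: u + v) :: w2) = a *: f (w1 ++ u :: w2) + f (w1 ++ v :: w2).

Lemma multilinear_ten : multilinear ten.
Proof.
move=> w1 w2 a u v.
have -> : ten (w1 ++ (a *: u + v) :: w2) =
    ten (w1 ++ (a *: u) :: w2) + ten (w1 ++ v :: w2).
  by rewrite [RHS]pi_tensor_add; apply/pi_tensorP/tensor_eq_vecD.
congr (_ + _); rewrite [RHS]pi_tensor_scale /= mulr1 -[X in (X, _)]mul1r.
exact/pi_tensorP/tensor_eq_vecZ.
Qed.

(* The linear extension of a map on pure tensors: see tlift_ten. *)
Definition tlift (M : lmodType k) (f : seq L -> M) (t : T) : M :=
  \sum_(aw <- repr t) aw.1 *: f aw.2.

Section Lift.

Variables (M : lmodType k) (f : seq L -> M).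
Hypothesis f_lin : multilinear f.

Lemma multilinearD w1 u v w2 :
  f (w1 ++ (u + v) :: w2) = f (w1 ++ u :: w2) + f (w1 ++ v :: w2).
Proof. by have := f_lin w1 w2 1 u v; rewrite !scale1r. Qed.

Lemma multilinear0 w1 w2 : f (w1 ++ 0 :: w2) = 0.
Proof. by apply: (addIr (f (w1 ++ 0 :: w2))); rewrite -multilinearD !add0r. Qed.

Lemma multilinearZ a w1 u w2 : f (w1 ++ (a *: u) :: w2) = a *: f (w1 ++ u :: w2).
Proof. by have := f_lin w1 w2 a u 0; rewrite multilinear0 !addr0. Qed.

Lemma tensor_eq_lift x y : tensor_eq x y ->
  \sum_(aw <- x) aw.1 *: f aw.2 = \sum_(aw <- y) aw.1 *: f aw.2.
Proof.
elim=> {x y} //=.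
- by move=> y x z _ -> _ ->.
- by move=> x y; rewrite !big_cat /= addrC.
- by move=> x x' y _ xx'; rewrite !big_cat /= xx'.
- by move=> w; rewrite big_seq1 big_nil scale0r.
- by move=> a b w; rewrite !big_cons !big_nil !addr0 /= scalerDl.
- by move=> a w1 u v w2; rewrite !big_cons !big_nil !addr0 /= multilinearD scalerDr.
- by move=> a c w1 u w2; rewrite !big_seq1 /= multilinearZ scalerA.
Qed.

Lemma tlift_pi x : tlift f (\pi_T x) = \sum_(aw <- x) aw.1 *: f aw.2.
Proof. by apply: tensor_eq_lift; apply/pi_tensorP; rewrite reprK. Qed.

Lemma tlift_ten w : tlift f (ten w) = f w.
Proof. by rewrite tlift_pi big_seq1 scale1r. Qed.

Lemma tlift_linear : linear (tlift f).
Proof.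
move=> a s t; elim/quotW: s => x; elim/quotW: t => y.
rewrite [X in X + _]pi_tensor_scale [X in tlift _ X]pi_tensor_add.
rewrite !tlift_pi big_cat big_map scaler_sumr; congr (_ + _).
by apply: eq_bigr => aw _; rewrite scalerA.
Qed.

End Lift.

Definition tensor_one : T := ten [::].
Definition tensor_mul (s t : T) : T :=
  tlift (fun w => tlift (fun w' => ten (w ++ w')) t) s.

Lemma multilinear_catl w : multilinear (fun w' => ten (w ++ w')).
Proof. by move=> w1 w2 a u v; rewrite !catA multilinear_ten. Qed.

Lemma multilinear_catr t :
  multilinear (fun w => tlift (fun w' => ten (w ++ w')) t).
Proof.
move=> w1 w2 a u v; rewrite /tlift scaler_sumr -big_split; apply: eq_bigr => aw _.
by rewrite -!catA !cat_cons multilinear_ten scalerDr !scalerA mulrC.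
Qed.

Lemma tensor_mul_ten w w' : tensor_mul (ten w) (ten w') = ten (w ++ w').
Proof.
rewrite /tensor_mul (tlift_ten (multilinear_catr _)).
by rewrite (tlift_ten (multilinear_catl _)).
Qed.

Lemma tensor_mul_linearl t : linear (tensor_mul^~ t).
Proof. by move=> a x y; apply: (tlift_linear (multilinear_catr t)). Qed.

Lemma tensor_mul_linearr s : linear (tensor_mul s).
Proof.
move=> a x y; rewrite /tensor_mul.
have E g : tlift g s = \sum_(aw <- repr s) aw.1 *: g aw.2 :> T by [].
rewrite !E scaler_sumr -big_split.
apply: eq_bigr => bw _.
have /= -> := tlift_linear (multilinear_catl bw.2) a x y.
by rewrite scalerDr !scalerA mulrC.
Qed.

Lemma tensor_ind (P : T -> Prop) :
  (forall w, P (ten w)) -> (forall a s t, P s -> P t -> P (a *: s + t)) ->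
  forall t, P t.
Proof.
move=> Pten Plin t; rewrite (tensor_spanE t).
have P0 : P 0 by rewrite -(addNr (ten [::])) -scaleN1r; exact: Plin.
by elim/big_rec: _ => // aw s _; exact: Plin.
Qed.

Lemma tensor_mulA : associative tensor_mul.
Proof.
move=> x y z; elim/tensor_ind: x => [w1|a s t IHs IHt]; last first.
  by rewrite !tensor_mul_linearl IHs IHt.
elim/tensor_ind: y => [w2|a s t IHs IHt]; last first.
  by rewrite tensor_mul_linearl !tensor_mul_linearr tensor_mul_linearl IHs IHt.
elim/tensor_ind: z => [w3|a s t IHs IHt]; last first.
  by rewrite !tensor_mul_linearr IHs IHt.
by rewrite !tensor_mul_ten catA.
Qed.

Lemma tensor_mul1l : left_id tensor_one tensor_mul.
Proof.
elim/tensor_ind=> [w|a s t IHs IHt]; first by rewrite tensor_mul_ten.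
by rewrite tensor_mul_linearr IHs IHt.
Qed.

Lemma tensor_mul1r : right_id tensor_one tensor_mul.
Proof.
elim/tensor_ind=> [w|a s t IHs IHt]; first by rewrite tensor_mul_ten cats0.
by rewrite tensor_mul_linearl IHs IHt.
Qed.

Lemma tensor_mulDl : left_distributive tensor_mul +%R.
Proof. by move=> x y z; rewrite -[x]scale1r tensor_mul_linearl !scale1r. Qed.

Lemma tensor_mulDr : right_distributive tensor_mul +%R.
Proof. by move=> x y z; rewrite -[y]scale1r tensor_mul_linearr !scale1r. Qed.

HB.instance Definition _ := GRing.Zmodule_isPzRing.Build T
  tensor_mulA tensor_mul1l tensor_mul1r tensor_mulDl tensor_mulDr.

Lemma tensor_scaleAl (a : k) (x y : T) : a *: (x * y) = a *: x * y.
Proof. by have /= := tensor_mul_linearl y a x 0; rewrite (mul0r y : tensor_mul 0 y = 0) !addr0. Qed.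

Lemma tensor_scaleAr (a : k) (x y : T) : a *: (x * y) = x * (a *: y).
Proof. by have /= := tensor_mul_linearr x a y 0; rewrite (mulr0 x : tensor_mul x 0 = 0) !addr0. Qed.

(* The identification of L with its first tensor power. *)
Definition tvec (u : L) : T := ten [:: u].

Lemma tvec_linear : linear tvec.
Proof. by move=> a u v; exact: (multilinear_ten [::] [::]). Qed.

HB.instance Definition _ := GRing.isLinear.Build k L T *:%R tvec tvec_linear.

Lemma ten_prod w : ten w = \prod_(u <- w) tvec u.
Proof.
by elim: w => [|u w IHw]; rewrite ?big_nil// big_cons -IHw [RHS]tensor_mul_ten.
Qed.

Definition pull_front (w : seq L) : T :=
  \sum_(i < size w) ten (nth 0 w i :: take i w ++ drop i.+1 w).

Definition tprime : T -> T := tlift pull_front.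

Lemma multilinear_pull_front : multilinear pull_front.
Proof.
move=> w1 w2 a u v; rewrite /pull_front !size_cat /= scaler_sumr -big_split.
apply: eq_bigr => -[i /= _] _; rewrite !nth_cat !take_cat !drop_cat.
case: (ltngtP i (size w1)) => [lt_i|lt_i|->].
- have [lt_i1|le_i1] := ltnP i.+1 (size w1).
    by rewrite -!cat_cons !catA multilinear_ten.
  move: lt_i; rewrite -subn_eq0 => /eqP -> /=.
  by rewrite -!cat_cons multilinear_ten.
- rewrite ltnNge (leqW (ltnW lt_i)) /= (subSn (ltnW lt_i)) -(subnSK lt_i) /=.
  by rewrite -!catA -!cat_cons multilinear_ten.
- by rewrite ltnNge leqnSn subSnn subnn /= drop0 !cats0 (multilinear_ten [::]).
Qed.

Lemma tprime_linear : linear tprime.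
Proof. exact: (tlift_linear multilinear_pull_front). Qed.

HB.instance Definition _ := GRing.isLinear.Build k T T *:%R tprime tprime_linear.

Lemma tprime_ten w :
  tprime (ten w) = \sum_(i < size w) ten (nth 0 w i :: take i w ++ drop i.+1 w).
Proof. exact: (tlift_ten multilinear_pull_front). Qed.

Definition mulsub (A B : set T) : set T := span [set x * y | x in A & y in B].

Fixpoint powsub (U : set T) (i : nat) : set T :=
  if i is j.+1 then mulsub U (powsub U j) else span [set 1 : T].

Definition star (U : set T) : set T := sumsub (powsub U).

Definition bracket (A B : set T) : set T := span [set x * y - y * x | x in A & y in B].

(* Lprime i is L'_{i+1}: the indexing is shifted by one. *)
Fixpoint Lprime (i : nat) : set T :=
  if i is j.+1 then bracket (range tvec) (Lprime j) else range tvec.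

Definition gbarprime : set T := sumsub (fun i => Lprime i.+1).

Definition power_sub (p : nat) : set T := span (range (fun u => tvec u ^+ p)).

Definition hprime (p : nat) : set T := addsub gbarprime (power_sub p).

End TensorAlgebra.

Arguments Lprime {k} L i.
Arguments gbarprime {k} L.
Arguments power_sub {k} L p.
Arguments hprime {k} L p.

(* Main.v *)
(* For a linear form f on L, contracting the first letter of t' x with f gives
   a derivation d_f of T(L), and d_f vanishes on Ker t'. Let H = (h'_p)^*. In
   characteristic p, [u, x^p] = - ad_x^p u lies in g', so H is normalized by L;
   hence, for a vector e, the sums of the e^j h_j with h_j in H and j < p form a
   subalgebra, which is again normalized by L. Adjoining basis vectors e_1, ...,
   e_n one at a time in this way reaches every element of T(L). The derivation
   dual to the last vector adjoined kills the previous subalgebra and maps e^j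
   to j e^(j-1), where j is invertible for 0 < j < p; so an element of Ker t'
   only has a term with j = 0, and it descends step by step to H. *)
Require Import Defs.
From HB Require Import structures.
From mathcomp Require Import all_boot all_order all_algebra.
From mathcomp Require Import boolp classical_sets.

Set Implicit Arguments.
Unset Strict Implicit.
Unset Printing Implicit Defensive.

Import GRing.Theory.

Local Open Scope classical_set_scope.
Local Open Scope ring_scope.

(** * Submodules, spans and sums of submodules *)

Section Submodules.

Context {k : pzRingType} {V : lmodType k}.
Implicit Types (S A : set V).

Lemma submoduleD A x y : submodule A -> A x -> A y -> A (x + y).
Proof. by move=> [_ Alin] Ax Ay; rewrite -[x]scale1r; exact: Alin. Qed.

Lemma submoduleZ A a x : submodule A -> A x -> A (a *: x).
Proof. by move=> [A0 Alin] Ax; rewrite -[_ *: _]addr0; exact: Alin. Qed.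

Lemma submoduleN A x : submodule A -> A x -> A (- x).
Proof. by move=> smA Ax; rewrite -scaleN1r; exact: submoduleZ. Qed.

Lemma submoduleB A x y : submodule A -> A x -> A y -> A (x - y).
Proof. by move=> smA Ax Ay; apply: submoduleD => //; exact: submoduleN. Qed.

Lemma submodule_sum A (I : Type) (r : seq I) (P : pred I) (F : I -> V) :
  submodule A -> (forall i, P i -> A (F i)) -> A (\sum_(i <- r | P i) F i).
Proof.
move=> smA AF; elim/big_ind: _ => //; first by case: smA.
by move=> x y; exact: submoduleD.
Qed.

Lemma span_submodule S : submodule (Defs.span S).
Proof.
split=> [A [[A0 _] _] //|a x y Sx Sy A [smA SA]].
by apply: smA.2; [apply: Sx | apply: Sy].
Qed.

Lemma sub_span S : S `<=` Defs.span S.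
Proof. by move=> x Sx A [_]; exact. Qed.

Lemma span_min S A : submodule A -> S `<=` A -> Defs.span S `<=` A.
Proof. by move=> smA SA x; apply. Qed.

Lemma sumsub_submodule (A : nat -> set V) : submodule (sumsub A).
Proof. exact: span_submodule. Qed.

Lemma sub_sumsub (A : nat -> set V) i : A i `<=` sumsub A.
Proof. by move=> x Aix; apply: sub_span; exists i. Qed.

Lemma sumsub_min (A : nat -> set V) S :
  submodule S -> (forall i, A i `<=` S) -> sumsub A `<=` S.
Proof. by move=> smS AS; apply: span_min => // x [i _]; exact: AS. Qed.

Lemma addsubl A S : submodule S -> A `<=` addsub A S.
Proof. by move=> [S0 _] x Ax; exists x => //; exists 0; rewrite ?addr0. Qed.

Lemma addsubr A S : submodule A -> S `<=` addsub A S.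
Proof. by move=> [A0 _] x Sx; exists 0 => //; exists x; rewrite ?add0r. Qed.

End Submodules.

(** * Coordinates in a basis and dual functionals *)

Section Coordinates.

Context {k : pzRingType} {V : lmodType k} (B : set V).

(** Requiring [c] to vanish outside the support [s] makes it comparable as a function on all of [V],
    whatever list witnesses it. *)
Definition coordinates (u : V) (c : V -> k) : Prop :=
  exists s : seq V, [/\ uniq s, forall v, v \in s -> B v,
    forall v, v \notin s -> c v = 0 & u = \sum_(v <- s) c v *: v].

Lemma sum_support (s s' : seq V) (c : V -> k) :
  uniq s -> uniq s' -> {subset s <= s'} -> (forall v, v \notin s -> c v = 0) ->
  \sum_(v <- s') c v *: v = \sum_(v <- s) c v *: v.
Proof.
move=> us us' ss' c0; rewrite (bigID (mem s)) /= [X in _ + X]big1 ?addr0.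
  rewrite -big_filter; apply: perm_big; apply: uniq_perm => //.
    exact: filter_uniq.
  by move=> v; rewrite mem_filter; apply: andb_idr; exact: ss'.
by move=> v /c0 ->; rewrite scale0r.
Qed.

Lemma coordinates_linear a u v c d : coordinates u c -> coordinates v d ->
  coordinates (a *: u + v) (fun x => a * c x + d x).
Proof.
move=> [s [us sB c0 ->]] [s' [us' sB' d0 ->]].
exists (undup (s ++ s')); split; first exact: undup_uniq.
- by move=> x; rewrite mem_undup mem_cat => /orP[/sB|/sB'].
- move=> x; rewrite mem_undup mem_cat negb_or => /andP[/c0 -> /d0 ->].
  by rewrite mulr0 addr0.
rewrite -(sum_support us (undup_uniq (s ++ s')) _ c0); last first.
  by move=> x xs; rewrite mem_undup mem_cat xs.
rewrite -(sum_support us' (undup_uniq (s ++ s')) _ d0); last first.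
  by move=> x xs; rewrite mem_undup mem_cat xs orbT.
rewrite scaler_sumr -big_split; apply: eq_bigr => x _.
by rewrite scalerDl scalerA.
Qed.

Lemma coordinates_basis b : B b -> coordinates b (fun v => (v == b)%:R).
Proof.
move=> Bb; exists [:: b]; split=> //.
- by move=> v; rewrite inE => /eqP ->.
- by move=> v; rewrite inE => /negbTE ->.
by rewrite big_seq1 eqxx scale1r.
Qed.

Hypotheses (B_indep : lin_indep B) (B_span : Defs.span B = setT).

(** The difference of the two families is a coordinate family of 0: independence kills it on its
    support, and it vanishes elsewhere. *)
Lemma coordinates_unique u c d : coordinates u c -> coordinates u d -> c =1 d.
Proof.
move=> uc ud v; have := coordinates_linear (-1) ud uc.
rewrite scaleN1r addNr => -[s [us sB cd0 /esym sum0]].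
have cd : -1 * d v + c v = 0.
  by have [/(B_indep us sB sum0)|/cd0] := boolP (v \in s).
by apply/eqP; rewrite -subr_eq0 addrC -mulN1r cd.
Qed.

Lemma coordinates_exist u : exists c, coordinates u c.
Proof.
have : Defs.span B u by rewrite B_span.
move: u; apply: span_min => [|b Bb]; last first.
  by exists (fun v => (v == b)%:R); exact: coordinates_basis.
split=> [|a u v [c uc] [d vd]]; last by eexists; exact: coordinates_linear uc vd.
by exists (fun=> 0), [::]; split=> //; rewrite big_nil.
Qed.

(** Choose a coordinate family for each vector and read off its entry at [b]; uniqueness of
    coordinates makes this linear. *)
Lemma coordinate_functional b : B b -> exists f : V -> k,
  [/\ forall a u v, f (a *: u + v) = a * f u + f v, f b = 1 &
      forall b', B b' -> b' != b -> f b' = 0].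
Proof.
move=> Bb; pose c u := sval (cid (coordinates_exist u)).
have cP u : coordinates u (c u) by rewrite /c; case: cid.
exists (fun u => c u b); split=> [a u v||b' Bb' b'b].
- exact: (coordinates_unique (cP _) (coordinates_linear _ (cP u) (cP v))).
- by rewrite (coordinates_unique (cP b) (coordinates_basis Bb)) eqxx.
- by rewrite (coordinates_unique (cP b') (coordinates_basis Bb')) eq_sym (negbTE b'b).
Qed.

End Coordinates.

(** * Subalgebras of the tensor algebra and their generation *)

Section TensorAlgebra.

Context {k : comPzRingType} {L : lmodType k}.
Local Notation T := (tensor_algebra L).
Implicit Types (x y z : T) (A W U : set T).

Definition subalgebra A : Prop :=
  [/\ submodule A, A 1 & forall x y, A x -> A y -> A (x * y)].

Definition normalized A : Prop :=
  forall (u : L) y, A y -> A (tvec u * y - y * tvec u).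

Lemma ten_mul (w w' : seq L) : ten w * ten w' = ten (w ++ w').
Proof. exact: tensor_mul_ten. Qed.

Lemma ten_cons (u : L) w : ten (u :: w) = tvec u * ten w.
Proof. by rewrite ten_mul. Qed.

Lemma subalgebraX A x n : subalgebra A -> A x -> A (x ^+ n).
Proof.
move=> [_ A1 AM] Ax; elim: n => [|n IHn]; first by rewrite expr0.
by rewrite exprS; exact: AM.
Qed.

Section Star.

Variable U : set T.

Lemma star_submodule : submodule (star U).
Proof. exact: sumsub_submodule. Qed.

Lemma star_1 : star U 1.
Proof. by apply: (@sub_sumsub _ _ _ 0); exact: sub_span. Qed.

Lemma star_mull x y : U x -> star U y -> star U (x * y).
Proof.
move=> Ux; move: y; apply: sumsub_min => [|i y Uy].
  split=> [|a y z Uy Uz] /=; first by rewrite mulr0; case: star_submodule.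
  by rewrite mulrDr -tensor_scaleAr; exact: star_submodule.2.
by apply: (@sub_sumsub _ _ _ i.+1); apply: sub_span; exists x => //; exists y.
Qed.

(** The left factor is decomposed: powers of [U] grow on the left, so its letters move onto [y] one
    at a time by [star_mull]. *)
Lemma star_subalgebra : subalgebra (star U).
Proof.
split; [exact: star_submodule | exact: star_1 |] => x y sx sy; move: x sx.
have sm : submodule [set x : T | star U (x * y)].
  split=> [|a x z Ux Uz] /=; first by rewrite mul0r; case: star_submodule.
  by rewrite mulrDl -tensor_scaleAl; exact: star_submodule.2.
apply: sumsub_min => // i; elim: i => [|i IHi] /=; apply: span_min => // x.
  by move=> -> /=; rewrite mul1r.
by move=> [u Uu [v Uv <-]] /=; rewrite -mulrA; apply: star_mull => //; exact: IHi.
Qed.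

Lemma sub_star : U `<=` star U.
Proof. by move=> x Ux; rewrite -[x]mulr1; apply: star_mull => //; exact: star_1. Qed.

Lemma star_min A : subalgebra A -> U `<=` A -> star U `<=` A.
Proof.
move=> [smA A1 AM] UA; apply: sumsub_min => // i.
elim: i => [|i IHi] /=; apply: span_min => // x; first by move=> ->.
by move=> [u /UA Au [v /IHi Av <-]]; exact: AM.
Qed.

End Star.

(** * Commutators with vectors of [L] *)

Lemma commutator_mul x y z :
  x * (y * z) - y * z * x = (x * y - y * x) * z + y * (x * z - z * x).
Proof. by rewrite mulrBl mulrBr !mulrA addrA subrK. Qed.

Lemma ad_ker_submodule A (u : L) : submodule A ->
  submodule [set y | A (tvec u * y - y * tvec u)].
Proof.
move=> smA; split=> [|a x y /= Ax Ay] /=; first by rewrite mulr0 mul0r subr0; case: smA.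
rewrite mulrDl mulrDr -tensor_scaleAl -tensor_scaleAr opprD addrACA -scalerBr.
exact: smA.2.
Qed.

(** Products are handled by the Leibniz rule [commutator_mul]. This reduces normalization to a check
    on generators. *)
Lemma normalized_subalgebra A (u : L) : subalgebra A ->
  subalgebra [set y | A y /\ A (tvec u * y - y * tvec u)].
Proof.
move=> [smA A1 AM]; split.
- split=> [|a x y [Ax Aux] [Ay Auy]] /=.
    by rewrite mulr0 mul0r subr0; case: smA.
  by split; [exact: smA.2 | exact: (ad_ker_submodule u smA).2].
- by split; rewrite ?mulr1 ?mul1r ?subrr //; case: smA.
move=> x y [Ax Aux] [Ay Auy] /=; split; first exact: AM.
by rewrite commutator_mul; apply: submoduleD => //; exact: AM.
Qed.

Lemma star_normalized U :
  (forall (u : L) y, U y -> star U (tvec u * y - y * tvec u)) -> normalized (star U).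
Proof.
move=> UN u y Uy.
suff [] : [set y | star U y /\ star U (tvec u * y - y * tvec u)] y by [].
move: y Uy; apply: star_min.
  exact/normalized_subalgebra/star_subalgebra.
by move=> y Uy; split; [exact: sub_star | exact: UN].
Qed.

(** * The product rule for [tprime] *)

Definition insert_second x : T -> T :=
  tlift (fun w => if w is u :: w' then tvec u * (x * ten w') else 0).

Lemma insert_second_multilinear x :
  multilinear (fun w => if w is u :: w' then tvec u * (x * ten w') else 0 : T).
Proof.
move=> [|v w1] w2 a u u' /=.
  by rewrite linearP mulrDl -tensor_scaleAl.
by rewrite multilinear_ten !mulrDr -!tensor_scaleAr.
Qed.

Lemma insert_second_ten x u w :
  insert_second x (ten (u :: w)) = tvec u * (x * ten w).
Proof. exact: (tlift_ten (insert_second_multilinear x)). Qed.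

Lemma insert_second_linear x : linear (insert_second x).
Proof. exact: (tlift_linear (insert_second_multilinear x)). Qed.

HB.instance Definition _ x :=
  GRing.isLinear.Build k T T *:%R (insert_second x) (insert_second_linear x).

Lemma insert_second_linearl y : linear (insert_second^~ y).
Proof.
move=> a x z; elim/tensor_ind: y => [[|u w]|b s t IHs IHt].
- by rewrite /insert_second !(tlift_ten (insert_second_multilinear _)) scaler0 addr0.
- by rewrite !insert_second_ten mulrDl mulrDr -tensor_scaleAl -tensor_scaleAr.
- rewrite /= !linearP /= IHs IHt !scalerDr !scalerA addrACA.
  by rewrite [b * a]mulrC.
Qed.

(** A letter pulled to the front of [x * y] comes from [x], or it comes from [y] and then has [x]
    right behind it. The default 0 of [insert_second] on the empty word does no harm, as [tprime y]
    has no part of degree 0. *)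
Lemma tprimeM x y : tprime (x * y) = tprime x * y + insert_second x (tprime y).
Proof.
elim/tensor_ind: x => [w|a s t IHs IHt]; last first.
  rewrite mulrDl -tensor_scaleAl !linearP /= IHs IHt insert_second_linearl.
  by rewrite mulrDl -tensor_scaleAl scalerDr addrACA.
elim/tensor_ind: y => [w'|a s t IHs IHt]; last first.
  rewrite mulrDr -tensor_scaleAr !linearP /= IHs IHt.
  by rewrite mulrDr -tensor_scaleAr scalerDr addrACA.
rewrite ten_mul !tprime_ten size_cat big_split_ord mulr_suml linear_sum.
congr (_ + _); apply: eq_bigr => i _ /=.
  rewrite nth_cat ltn_ord takel_cat; last exact: ltnW.
  rewrite ten_mul /= -catA; congr (ten (_ :: _ ++ _)).
  (* Boundary case: if [i] is the last position of [w], the [drop] falls exactly at the start of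
     [w']. *)
  rewrite drop_cat; case: ltnP => // le_i.
  have -> : i.+1 = size w by apply/eqP; rewrite eqn_leq ltn_ord.
  by rewrite subnn drop0 drop_size.
rewrite insert_second_ten ten_mul -ten_cons.
rewrite nth_cat ltnNge leq_addr /= addKn take_cat ltnNge leq_addr /= addKn.
rewrite drop_cat ltnNge -addnS leq_addr /= addKn.
by rewrite catA.
Qed.

Lemma tprime1 : tprime (1 : T) = 0.
Proof. by rewrite [LHS]tprime_ten big_ord0. Qed.

Lemma tprime_tvec (u : L) : tprime (tvec u) = tvec u.
Proof. by rewrite tprime_ten big_ord_recl big_ord0 addr0. Qed.

Lemma tprime_ker_subalgebra : subalgebra [set x : T | tprime x = 0].
Proof.
split=> [||x y /= x0 y0]; last by rewrite tprimeM x0 y0 mul0r linear0 addr0.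
  by split=> [|a x y /= x0 y0]; rewrite /= ?linear0 // linearP /= x0 y0 scaler0 addr0.
exact: tprime1.
Qed.

Lemma insert_second_tvec x (u : L) : insert_second x (tvec u) = tvec u * x.
Proof. by rewrite insert_second_ten; congr (_ * _); exact: mulr1. Qed.

(** As [tprime x = 0], only [u] can be pulled forward, so both products have image [tvec u * x]. *)
Lemma tprime_commutator (u : L) x : tprime x = 0 ->
  tprime (tvec u * x - x * tvec u) = 0.
Proof.
by move=> x0; rewrite linearB /= !tprimeM tprime_tvec x0 linear0 addr0 mul0r add0r
  insert_second_tvec subrr.
Qed.

Lemma tprime_tvecX (u : L) n : tprime (tvec u ^+ n) = tvec u ^+ n *+ n.
Proof.
elim: n => [|n IHn]; first exact: tprime1.
rewrite exprS tprimeM tprime_tvec IHn linearMn mulrSr addrC -exprS /=.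
(* For [n = 0] there is no first letter to insert behind, but the multiplicity is 0. *)
case: n {IHn} => [|n]; first by rewrite !mulr0n.
have E m : tvec u ^+ m = ten (nseq m u) by rewrite ten_prod big_nseq iter_mulr_1.
by rewrite !E /= insert_second_ten -!ten_cons.
Qed.

(** * Derivations obtained by contracting [tprime] with a linear form *)

Section Derivation.

Variable f : L -> k.
Hypothesis f_lin : forall a u v, f (a *: u + v) = a * f u + f v.

Definition contract : T -> T :=
  tlift (fun w => if w is u :: w' then f u *: ten w' else 0).

Lemma contract_multilinear :
  multilinear (fun w => if w is u :: w' then f u *: ten w' else 0 : T).
Proof.
move=> [|v w1] w2 a u u' /=; first by rewrite f_lin scalerDl scalerA.
by rewrite multilinear_ten scalerDr !scalerA mulrC.
Qed.

Lemma contract_linear : linear contract.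
Proof. exact: (tlift_linear contract_multilinear). Qed.

HB.instance Definition _ := GRing.isLinear.Build k T T *:%R contract contract_linear.

Lemma contract_tvecM (u : L) x : contract (tvec u * x) = f u *: x.
Proof.
elim/tensor_ind: x => [w|a s t IHs IHt].
  by rewrite -ten_cons /contract (tlift_ten contract_multilinear).
rewrite mulrDr -tensor_scaleAr !linearP /= IHs IHt.
by rewrite !scalerA mulrC.
Qed.

Lemma contract1 : contract 1 = 0.
Proof. exact: (tlift_ten contract_multilinear). Qed.

(** Once the first letter is contracted, the inserted [x] leads; this turns the second term of
    [tprimeM] into that of the Leibniz rule. *)
Lemma contract_insert_second x y : contract (insert_second x y) = x * contract y.
Proof.
elim/tensor_ind: y => [[|u w]|a s t IHs IHt].
- rewrite [X in _ * X]contract1 mulr0 /insert_second.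
  by rewrite (tlift_ten (insert_second_multilinear x)) linear0.
- by rewrite insert_second_ten ten_cons !contract_tvecM tensor_scaleAr.
- by rewrite !linearP /= IHs IHt mulrDr -tensor_scaleAr.
Qed.

Definition derivation x : T := contract (tprime x).

Lemma derivation_linear : linear derivation.
Proof. by move=> a x y; rewrite /derivation !linearP. Qed.

HB.instance Definition _ :=
  GRing.isLinear.Build k T T *:%R derivation derivation_linear.

Lemma derivationM x y : derivation (x * y) = derivation x * y + x * derivation y.
Proof.
rewrite /derivation tprimeM linearD /= contract_insert_second; congr (_ + _).
(* Right multiplication by [y] commutes with [contract] on tensors without constant part, and every
   term of [tprime x] begins with a letter. *)
elim/tensor_ind: x => [w|a s t IHs IHt]; last first.
  by rewrite linearP mulrDl -tensor_scaleAl !linearP /= IHs IHt mulrDl -tensor_scaleAl.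
rewrite tprime_ten mulr_suml !linear_sum mulr_suml; apply: eq_bigr => i _ /=.
by rewrite ten_cons -mulrA !contract_tvecM tensor_scaleAl.
Qed.

Lemma derivation_tvec (u : L) : derivation (tvec u) = f u *: (1 : T).
Proof. by rewrite /derivation tprime_tvec -[tvec u]mulr1 contract_tvecM. Qed.

Lemma derivation_tprime_ker x : tprime x = 0 -> derivation x = 0.
Proof. by rewrite /derivation => ->; exact: linear0. Qed.

Lemma derivation1 : derivation 1 = 0.
Proof. exact/derivation_tprime_ker/tprime1. Qed.

Lemma derivation_ker_subalgebra : subalgebra [set x : T | derivation x = 0].
Proof.
split=> [||x y /= x0 y0]; last by rewrite derivationM x0 y0 mul0r mulr0 addr0.
  by split=> [|a x y /= x0 y0]; rewrite /= ?linear0 // linearP /= x0 y0 scaler0 addr0.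
exact: derivation1.
Qed.

Lemma derivationX x n : derivation x = 1 -> derivation (x ^+ n) = x ^+ n.-1 *+ n.
Proof.
move=> x1; elim: n => [|n IHn]; first exact: derivation1.
rewrite exprS derivationM x1 mul1r IHn mulrSr addrC mulrnAr; congr (_ + _).
by case: n {IHn} => [|n]; rewrite ?mulr0n // -exprS.
Qed.

Lemma derivation_power_sum x n (c : nat -> T) :
  derivation x = 1 -> (forall j, derivation (c j) = 0) ->
  derivation (\sum_(j < n.+1) x ^+ j * c j) = \sum_(j < n) x ^+ j * (c j.+1 *+ j.+1).
Proof.
move=> x1 c0; rewrite linear_sum big_ord_recl /= derivationM c0 derivation1.
rewrite mul0r mulr0 addr0 add0r; apply: eq_bigr => j _.
by rewrite derivationM c0 mulr0 addr0 derivationX // mulrnAl mulrnAr.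
Qed.

(** Differentiating shortens the relation and replaces the coefficients by [c j.+1 *+ j.+1]; the
    bound [n <= p] keeps the factors [j.+1] invertible. *)
Lemma power_sum_indep (p : nat) x n (c : nat -> T) :
  (forall j, (0 < j < p)%N -> exists a : k, a * j%:R = 1) ->
  derivation x = 1 -> (forall j, derivation (c j) = 0) -> (n <= p)%N ->
  \sum_(j < n) x ^+ j * c j = 0 -> forall j, (j < n)%N -> c j = 0.
Proof.
move=> p_inv x1; elim: n c => // n IHn c c0 lt_np sum0.
have cS j : (j < n)%N -> c j.+1 = 0.
  move=> lt_jn; have [|a aj] := p_inv j.+1; first exact: leq_ltn_trans lt_np.
  rewrite -[c _]scale1r -aj -scalerA scaler_nat.
  rewrite (IHn (fun j => c j.+1 *+ j.+1)) ?scaler0 //; last 2 first.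
  - exact: ltnW.
  - by rewrite -derivation_power_sum // sum0 linear0.
  by move=> i; rewrite linearMn /= c0 mul0rn.
case=> [_|j]; last exact: cS.
move: sum0; rewrite big_ord_recl mul1r big1 ?addr0 // => i _.
by rewrite cS ?mulr0.
Qed.

(** The derivative is a vanishing sum of [p - 1] terms, to which [power_sum_indep] applies; dividing
    by [i.+1] kills every coefficient except [c 0]. *)
Lemma power_sum_ker (p : nat) x (c : nat -> T) :
  (forall j, (0 < j < p)%N -> exists a : k, a * j%:R = 1) -> (0 < p)%N ->
  derivation x = 1 -> (forall j, derivation (c j) = 0) ->
  derivation (\sum_(j < p) x ^+ j * c j) = 0 -> \sum_(j < p) x ^+ j * c j = c 0.
Proof.
case: p => // n p_inv _ x1 c0; rewrite derivation_power_sum // => sum0.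
rewrite big_ord_recl mul1r big1 ?addr0 // => i _.
have [|a ai] := p_inv i.+1; first by rewrite ltn0Sn ltnS ltn_ord.
have ci0 : c i.+1 *+ i.+1 = 0.
  apply: (power_sum_indep (c := fun j => c j.+1 *+ j.+1) p_inv x1 _ (leqnSn n)) => // j.
  by rewrite linearMn /= c0 mul0rn.
by rewrite -[c _]scale1r -ai -scalerA scaler_nat ci0 scaler0 mulr0.
Qed.

End Derivation.

(** * Iterated commutators and [p]-th powers *)

Definition ad x y := x * y - y * x.

(** Left multiplication by [x] is the sum of [ad x] and right multiplication by [x], which commute,
    so this is the binomial theorem. The free bound [m] lets the two sums in Pascal's rule be
    aligned. *)
Lemma ad_exp x y n m : (n < m)%N ->
  x ^+ n * y = \sum_(i < m) iter i (ad x) y * x ^+ (n - i) *+ 'C(n, i).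
Proof.
elim: n m y => [|n IHn] [//|m] y lt_nm.
  by rewrite big_ord_recl big1 ?addr0 /= ?mul1r ?mulr1.
have -> : x ^+ n.+1 * y = x ^+ n * (ad x y + y * x) by rewrite subrK exprSr mulrA.
rewrite mulrDr mulrA (IHn m) // (IHn m.+1) 1?ltnW // mulr_suml !big_ord_recl /=.
rewrite !bin0 !subn0 -mulrA -exprSr addrCA; congr (_ + _).
rewrite -big_split; apply: eq_bigr => i _ /=.
rewrite /bump /= !add1n binS subSS mulrnDr addrC -iterSr /=.
congr (_ + _); rewrite mulrnAl -mulrA -exprSr.
(* For [n <= i] the truncated exponents differ, but ['C(n, i.+1)] is 0. *)
by have [lt_in|le_ni] := ltnP i n; [rewrite subnSK | rewrite bin_small].
Qed.

(** In characteristic [p] only the binomial terms [i = 0] and [i = p] survive. *)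
Lemma ad_exp_prime (p : nat) x y : prime p -> p%:R = 0 :> k ->
  x ^+ p * y = y * x ^+ p + iter p (ad x) y.
Proof.
move=> p_pr p0; rewrite (@ad_exp _ _ _ p.+1) //.
have Tp0 z n : (p %| n)%N -> z *+ n = 0 :> T.
  by move=> /dvdnP[m ->]; rewrite -scaler_nat natrM p0 mulr0 scale0r.
case: p p_pr p0 Tp0 => // p p_pr p0 Tp0.
rewrite big_ord_recl big_ord_recr big1 => [|i _].
  by rewrite /= add0r bin0 /bump /= add1n binn subnn mulr1.
by rewrite Tp0 //= prime_dvd_bin // /bump /= add1n ltnS ltn_ord.
Qed.

(** * The generators in [hprime] *)

Lemma Lprime_ad (u : L) i y : Lprime L i y -> Lprime L i.+1 (ad (tvec u) y).
Proof. by move=> Ly; apply: sub_span; exists (tvec u); [exists u | exists y]. Qed.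

Lemma gbarprime_submodule : submodule (gbarprime L).
Proof. exact: sumsub_submodule. Qed.

Lemma iter_ad_gbarprime (u v : L) n :
  gbarprime L (iter n.+1 (ad (tvec u)) (tvec v)).
Proof.
apply: (@sub_sumsub _ _ _ n); elim: n.+1 => [|m IHm]; first by exists v.
exact: Lprime_ad.
Qed.

Lemma sub_gbarprime_hprime p : gbarprime L `<=` hprime L p.
Proof. exact/addsubl/span_submodule. Qed.

Lemma hprime_tvecX p (u : L) : hprime L p (tvec u ^+ p).
Proof.
by apply: addsubr; [exact: gbarprime_submodule | apply: sub_span; exists u].
Qed.

Lemma hprime_min p A : submodule A -> (forall i, Lprime L i.+1 `<=` A) ->
  (forall u : L, A (tvec u ^+ p)) -> hprime L p `<=` A.
Proof.
move=> smA LA PA _ [x gx [y Py <-]]; apply: submoduleD => //.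
  by move: x gx; apply: sumsub_min.
by move: y Py; apply: span_min => // _ [u _ <-].
Qed.

Lemma hprime_ad p (u : L) y : prime p -> p%:R = 0 :> k -> hprime L p y ->
  gbarprime L (tvec u * y - y * tvec u).
Proof.
move=> p_pr p0; move: y; apply: hprime_min => [|i y Ly|v] /=.
- exact/ad_ker_submodule/gbarprime_submodule.
- by apply: (@sub_sumsub _ _ _ i.+1); exact: Lprime_ad.
(* What remains of the commutator with [tvec v ^+ p] is the iterated one of length [p], and [p > 0]
   places it in [gbarprime]. *)
rewrite ad_exp_prime // opprD addrA subrr add0r.
apply: (submoduleN gbarprime_submodule).
by case: p p_pr p0 => // p _ _; exact: iter_ad_gbarprime.
Qed.

(** The induction starts at [[L, L]], because [tprime] fixes [L]: there [tprime (u v) = u v + v u]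
    is symmetric. Later brackets follow from [tprime_commutator], and [u^p] is multiplied by
    [p = 0]. *)
Lemma hprime_tprime p : p%:R = 0 :> k -> hprime L p `<=` [set x | tprime x = 0].
Proof.
move=> p0; have [sm _ _] := @tprime_ker_subalgebra.
apply: hprime_min => // [i|u] /=; last by rewrite tprime_tvecX -scaler_nat p0 scale0r.
elim: i => [|i IHi]; apply: span_min => // _ [_ [u _ <-] [y Ly <-]] /=.
  case: Ly => v _ <-; rewrite linearB /= !tprimeM !tprime_tvec !insert_second_tvec.
  by rewrite [X in _ - X]addrC subrr.
exact/tprime_commutator/IHi.
Qed.

(** * Adjoining one vector to a normalized subalgebra *)

Section Adjoin.

Variable p : nat.
Hypothesis p_gt0 : (0 < p)%N.

(** Exponents stop below [p] because [x ^+ p] will be assumed to lie in [W]. *)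
Definition adjoin W x : set T :=
  [set t | exists c : nat -> T,
     (forall j, W (c j)) /\ t = \sum_(j < p) x ^+ j * c j].

Lemma adjoin_min W x A : subalgebra A -> W `<=` A -> A x -> adjoin W x `<=` A.
Proof.
move=> saA WA Ax t [c [Wc ->]]; have [smA _ AM] := saA.
apply: submodule_sum => // j _; apply: AM; last exact: WA.
exact: subalgebraX.
Qed.

Variables (W : set T) (u : L).
Hypotheses (W_subalg : subalgebra W) (W_norm : normalized W).
Hypotheses (W_pow : W (tvec u ^+ p))
  (W_comm : forall v : L, W (tvec v * tvec u - tvec u * tvec v)).

Local Notation Wu := (adjoin W (tvec u)).

Let smW : submodule W. Proof. by case: W_subalg. Qed.
Let W1 : W 1. Proof. by case: W_subalg. Qed.
Let WM x y : W x -> W y -> W (x * y). Proof. by case: W_subalg => _ _; exact. Qed.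

Lemma adjoin_submodule : submodule Wu.
Proof.
split=> [|a x y [c [Wc ->]] [d [Wd ->]]].
  exists (fun=> 0); split=> [_|]; first by case: smW.
  by rewrite big1 // => j _; rewrite mulr0.
exists (fun j => a *: c j + d j); split=> [j|]; first exact: smW.2.
rewrite scaler_sumr -big_split; apply: eq_bigr => j _.
by rewrite mulrDr tensor_scaleAr.
Qed.

Lemma adjoin_monomial j w : (j < p)%N -> W w -> Wu (tvec u ^+ j * w).
Proof.
move=> lt_jp Ww; exists (fun i => if i == j then w else 0); split=> [i|].
  by case: eqP => // _; case: smW.
rewrite (bigD1 (Ordinal lt_jp)) //= eqxx big1 ?addr0 // => i /negbTE ij.
by rewrite (_ : (i == j :> nat) = false) ?mulr0.
Qed.

Lemma sub_adjoin : W `<=` Wu.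
Proof. by move=> w Ww; rewrite -[w]mul1r; apply: (@adjoin_monomial 0). Qed.

Lemma adjoin_mull x : Wu x -> Wu (tvec u * x).
Proof.
move=> [c [Wc ->]]; rewrite mulr_sumr; apply: submodule_sum.
  exact: adjoin_submodule.
move=> j _; rewrite mulrA -exprS.
(* The top exponent becomes [p], and [tvec u ^+ p] is absorbed into the coefficient. *)
have [->|neq_jp] := eqVneq j.+1 p; first exact/sub_adjoin/WM.
by apply: adjoin_monomial => //; rewrite ltn_neqAle neq_jp ltn_ord.
Qed.

Lemma adjoin_mulr x w : Wu x -> W w -> Wu (x * w).
Proof.
move=> [c [Wc ->]] Ww; exists (fun j => c j * w); split=> [j|]; first exact: WM.
by rewrite mulr_suml; apply: eq_bigr => j _; rewrite mulrA.
Qed.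

(** Moving [u] leftward across a coefficient [c j] costs [[u, c j]], which normalization keeps in
    [W]. *)
Lemma adjoin_mulr_gen x : Wu x -> Wu (x * tvec u).
Proof.
move=> [c [Wc ->]]; rewrite mulr_suml.
apply: (submodule_sum _ adjoin_submodule) => j _.
have -> : tvec u ^+ j * c j * tvec u =
    tvec u * (tvec u ^+ j * c j) - tvec u ^+ j * (tvec u * c j - c j * tvec u).
  by rewrite mulrBr !mulrA -exprS -exprSr opprB addrC subrK.
apply: (submoduleB adjoin_submodule).
  exact/adjoin_mull/adjoin_monomial.
by apply: adjoin_monomial => //; exact: W_norm.
Qed.

(** Expanding the right factor leaves only right multiplications by [u] and by elements of [W]. *)
Lemma adjoin_subalgebra : subalgebra Wu.
Proof.
split; [exact: adjoin_submodule | exact/sub_adjoin |].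
move=> x _ Wx [d [Wd ->]]; rewrite mulr_sumr.
apply: (submodule_sum _ adjoin_submodule) => j _; rewrite mulrA.
apply: adjoin_mulr => //; elim: (j : nat) => [|i IHi]; first by rewrite mulr1.
by rewrite exprSr mulrA; exact: adjoin_mulr_gen.
Qed.

Lemma adjoin_gen : Wu (tvec u).
Proof. by have := adjoin_mull (sub_adjoin W1); rewrite mulr1. Qed.

(** Commutators need checking only on [W] and on [u], where they already fall in [W]. *)
Lemma adjoin_normalized : normalized Wu.
Proof.
move=> v y Wy.
suff [] : [set y | Wu y /\ Wu (tvec v * y - y * tvec v)] y by [].
move: y Wy; apply: adjoin_min.
- exact/normalized_subalgebra/adjoin_subalgebra.
- by move=> w Ww; split; apply: sub_adjoin => //; exact: W_norm.
- by split; [exact: adjoin_gen | exact: sub_adjoin].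
Qed.

Lemma adjoin_derivation (f : L -> k) t :
  (forall a v v', f (a *: v + v') = a * f v + f v') ->
  (forall j, (0 < j < p)%N -> exists a : k, a * j%:R = 1) ->
  f u = 1 -> W `<=` [set x | derivation f x = 0] ->
  Wu t -> derivation f t = 0 -> W t.
Proof.
move=> f_lin p_inv fu W0 [c [Wc ->]] d0.
have u1 : derivation f (tvec u) = 1 by rewrite (derivation_tvec f_lin) fu scale1r.
have c0 j : derivation f (c j) = 0 by exact/W0/Wc.
by rewrite (power_sum_ker f_lin p_inv p_gt0 u1 c0 d0).
Qed.

End Adjoin.

(** * Towers of adjoined basis vectors *)

Definition tower p W (s : seq L) : set T :=
  foldr (fun u A => adjoin p A (tvec u)) W s.

Lemma tower_min p W s A : subalgebra A -> W `<=` A ->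
  (forall u, u \in s -> A (tvec u)) -> tower p W s `<=` A.
Proof.
move=> saA WA; elim: s => [|u s IHs] //= sA.
apply: adjoin_min => //; last by apply: sA; rewrite mem_head.
by apply: IHs => v vs; apply: sA; rewrite in_cons vs orbT.
Qed.

Section Tower.

Variables (p : nat) (W : set T).
Hypotheses (p_gt0 : (0 < p)%N) (W_subalg : subalgebra W) (W_norm : normalized W).
Hypotheses (W_pow : forall u : L, W (tvec u ^+ p))
  (W_comm : forall u v : L, W (tvec v * tvec u - tvec u * tvec v)).

Lemma tower_spec s :
  [/\ subalgebra (tower p W s), normalized (tower p W s) & W `<=` tower p W s].
Proof.
elim: s => [|u s [sa nm sW]]; [by split | split].
- by apply: adjoin_subalgebra => // *; exact: sW.
- by apply: adjoin_normalized => // *; exact: sW.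
- by move=> w /sW; exact: sub_adjoin.
Qed.

Lemma tower_mem s u : u \in s -> tower p W s (tvec u).
Proof.
elim: s => [|v s IHs] //=; have [sa nm sW] := tower_spec s.
rewrite in_cons => /predU1P[->|/IHs]; last exact: sub_adjoin.
by apply: adjoin_gen => // *; exact: sW.
Qed.

(** Towers over two lists both embed in the tower over their concatenation, so the elements lying in
    some tower form a subalgebra. It contains [B], hence [L], hence every word. *)
Lemma tower_exhaust (B : set L) t : Defs.span B = setT ->
  exists s, [/\ uniq s, forall u, u \in s -> B u & tower p W s t].
Proof.
move=> B_span.
pose A := [set x | exists s, [/\ uniq s, forall u, u \in s -> B u & tower p W s x]].
have A_op (op : T -> T -> T) :
    (forall s x y, tower p W s x -> tower p W s y -> tower p W s (op x y)) ->
    forall x y, A x -> A y -> A (op x y).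
  move=> opP x y [s [us sB sx]] [s' [us' sB' sy]].
  exists (undup (s ++ s')); split; first exact: undup_uniq.
    by move=> u; rewrite mem_undup mem_cat => /orP[/sB|/sB'].
  have [sa _ sW] := tower_spec (undup (s ++ s')).
  apply: opP; [move: x sx | move: y sy]; apply: tower_min => // u us_.
    by apply: tower_mem; rewrite mem_undup mem_cat us_.
  by apply: tower_mem; rewrite mem_undup mem_cat us_ orbT.
have A_W x : W x -> A x by exists [::].
have [smW W1 _] := W_subalg.
have smA : submodule A.
  split=> [|a x y Ax Ay]; first by apply: A_W; case: smW.
  apply: (A_op (fun x y => a *: x + y)) => // s x' y'.
  by have [[sm _ _] _ _] := tower_spec s; exact: sm.2.
have AM x y : A x -> A y -> A (x * y).
  by apply: A_op => s {}x {}y; have [[_ _ sM] _ _] := tower_spec s; exact: sM.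
have A_tvec u : A (tvec u).
  have : Defs.span B u by rewrite B_span.
  move: u; apply: (@span_min _ _ _ [set u | A (tvec u)]).
    split=> [|a u v Au Av] /=; first by rewrite linear0; case: smA.
    by rewrite linearP; exact: smA.2.
  move=> u Bu; exists [:: u]; split=> //; last exact/tower_mem/mem_head.
  by move=> v; rewrite inE => /eqP ->.
rewrite -/(A t); elim/tensor_ind: t => [w|a x y]; last exact: smA.2.
elim: w => [|u w IHw]; first exact: A_W.
by rewrite ten_cons; exact: AM.
Qed.

(** The head of [s] was adjoined last. Its dual derivation kills [W] and the other vectors of [s],
    hence the lower tower by [tower_min], so [adjoin_derivation] strips the head off. *)
Lemma tower_tprime_ker (B : set L) s t : lin_indep B -> Defs.span B = setT ->
  (forall j, (0 < j < p)%N -> exists a : k, a * j%:R = 1) ->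
  W `<=` [set x | tprime x = 0] -> uniq s -> (forall u, u \in s -> B u) ->
  tower p W s t -> tprime t = 0 -> W t.
Proof.
move=> B_indep B_span p_inv W0 + + + t0; elim: s => [|u s IHs] //= /andP[us uqs] sB.
move=> st; apply: IHs => // [v vs|]; first by apply: sB; rewrite in_cons vs orbT.
have [f [f_lin fu f0]] := coordinate_functional B_indep B_span (sB u (mem_head _ _)).
have d0 := derivation_tprime_ker f_lin.
have [sa nm sW] := tower_spec s.
apply: (adjoin_derivation p_gt0 (u := u) (f := f)) => //; last exact: d0.
apply: tower_min => [||v vs] /=.
- exact: derivation_ker_subalgebra.
- by move=> x /W0; exact: d0.
rewrite derivation_tvec // f0 ?scale0r //; first by apply: sB; rewrite in_cons vs orbT.
(* [s] has no repetition, so the later vectors differ from the head [u]. *)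
by apply: contraNneq us => <-.
Qed.

End Tower.

End TensorAlgebra.

(** * Integers in an [F_p]-algebra, and the theorem *)

Lemma Fp_algebra_natr0 (p : nat) (k : comPzRingType) (phi : {rmorphism 'F_p -> k}) :
  prime p -> p%:R = 0 :> k.
Proof.
by move=> p_pr; rewrite -(rmorph_nat phi) pchar_Fp_0 // rmorph0.
Qed.

(** The inverse is taken in the field ['F_p] and transported along [phi]. *)
Lemma Fp_algebra_natr_inv (p : nat) (k : comPzRingType) (phi : {rmorphism 'F_p -> k}) j :
  prime p -> (0 < j < p)%N -> exists a : k, a * j%:R = 1.
Proof.
move=> p_pr /andP[j_gt0 lt_jp]; exists (phi (j%:R)^-1).
rewrite -(rmorph_nat phi) -rmorphM mulVf ?rmorph1 //.
by rewrite -(dvdn_pcharf (pchar_Fp p_pr)) gtnNdvd.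
Qed.

(* The ring morphism phi is the structure of F_p-algebra on k. *)
Theorem theorem8p10 (p : nat) (hp : prime p) (k : comPzRingType)
    (phi : {rmorphism 'F_p -> k}) (L : lmodType k) (hL : free_module L) :
  star (hprime L p) = [set t : tensor_algebra L | tprime t = 0].
Proof.
have p0 := Fp_algebra_natr0 phi hp; have [B [B_indep B_span]] := hL.
have H_ker : star (hprime L p) `<=` [set t | tprime t = 0].
  by apply: star_min; [exact: tprime_ker_subalgebra | exact: hprime_tprime].
apply/seteqP; split=> // t t0.
have H_gbar : gbarprime L `<=` star (hprime L p).
  by move=> x gx; apply: sub_star; exact: sub_gbarprime_hprime.
have H_norm : normalized (star (hprime L p)).
  by apply: star_normalized => u y Hy; apply: H_gbar; exact: hprime_ad hp p0 Hy.
have H_pow u : star (hprime L p) (tvec u ^+ p) by apply: sub_star; exact: hprime_tvecX.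
have H_comm (u v : L) : star (hprime L p) (tvec v * tvec u - tvec u * tvec v).
  (* A single commutator is the iterated one of length 1. *)
  by apply: H_gbar; exact: (iter_ad_gbarprime v u 0).
have p_gt0 := prime_gt0 hp; have H_subalg := star_subalgebra (hprime L p).
have [s [us sB st]] :=
  tower_exhaust p_gt0 H_subalg H_norm H_pow H_comm t B_span.
apply: (tower_tprime_ker p_gt0 H_subalg H_norm H_pow H_comm B_indep B_span _
  H_ker us sB st t0).
by move=> j; exact: (Fp_algebra_natr_inv phi hp).
Qed.
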